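(* (Projective cross law) Let $\mathbb{F}$ be a field of characteristic not $2$ and let $B$ be an invertible symmetric $3\times 3$ matrix over $\mathbb{F}$. Let $\overline{p_1p_2p_3}$ be a tripod in $\mathbb{V}^3=\mathbb{F}^3$ whose $B$-projective quadrances $q_1,q_2,q_3$ and $B$-projective spreads $S_1,S_2,S_3$ are all defined, i.e. writing $p_i=[v_i]$, one has $Q_B(v_i)\neq 0$ for all $i$ and $Q_B(v_i\times_B v_j)\ne 0$ for all $i\neq j$. Let $a_B$ be its $B$-projective quadrea. Then $$(a_B-q_1-q_2-q_3+2)^2=4(1-q_1)(1-q_2)(1-q_3).$$
   Context: $\mathbb{V}^3$ is the space of row vectors over $\mathbb{F}$. The $B$-scalar product is $v\cdot_B w=vBw^T$ and $Q_B(v)=v\cdot_B v$. The Euclidean vector product is $(x_1,y_1,z_1)\times(x_2,y_2,z_2)=(y_1z_2-y_2z_1,\;x_2z_1-x_1z_2,\;x_1y_2-x_2y_1)$, and the $B$-vector product is $v\times_B w=(v\times w)\,\mathrm{adj}\,B$ with $\mathrm{adj}\,B=(\det B)B^{-1}$. A projective vector $p=[v]$ is the class of a non-zero vector $v$ modulo non-zero scalars. A tripod (projective triangle) $\overline{p_1p_2p_3}$ is a set of three distinct projective vectors $p_i=[v_i]$. The $B$-projective quadrance is $q_B([v],[w])=s_B(v,w)=1-\dfrac{(v\cdot_B w)^2}{Q_B(v)Q_B(w)}$, defined when $Q_B(v),Q_B(w)\neq0$. The $B$-projective quadrances of the tripod are $q_1=q_B(p_2,p_3)$, $q_2=q_B(p_1,p_3)$,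 $q_3=q_B(p_1,p_2)$. With $r_1=[v_2\times_B v_3]$, $r_2=[v_1\times_B v_3]$, $r_3=[v_1\times_B v_2]$ (the $B$-dual), the $B$-projective spreads are $S_1=q_B(r_2,r_3)$, $S_2=q_B(r_1,r_3)$, $S_3=q_B(r_1,r_2)$. The $B$-projective quadrea is the common value $a_B=S_1q_2q_3=S_2q_1q_3=S_3q_1q_2$. *)

(* Defs.v *)
From HB Require Import structures.
From mathcomp Require Import all_boot all_order all_algebra.
From mathcomp Require Import generic_quotient.
From mathcomp Require Import ring.

Set Implicit Arguments.
Unset Strict Implicit.
Unset Printing Implicit Defensive.

Import GRing.Theory.
Local Open Scope ring_scope.
Local Open Scope quotient_scope.

Section VectorAlgebra.
Variable F : fieldType.
Implicit Types (B : 'M[F]_3) (v w : 'rV[F]_3).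

Definition dotB B v w : F := (v *m B *m w^T) 0 0.

Definition QB B v : F := dotB B v v.

Definition row3 (x y z : F) : 'rV[F]_3 := \row_i [:: x; y; z]`_i.

Definition cross v w : 'rV[F]_3 :=
  let x1 := v 0 0 in let y1 := v 0 1 in let z1 := v 0 2%:R in
  let x2 := w 0 0 in let y2 := w 0 1 in let z2 := w 0 2%:R in
  row3 (y1 * z2 - y2 * z1) (x2 * z1 - x1 * z2) (x1 * y2 - x2 * y1).

Definition crossB B v w : 'rV[F]_3 := cross v w *m \adj B.

(* Meaningful when [QB B v] and [QB B w] are nonzero; otherwise the quotient
   takes the junk value 0. *)
Definition spreadB B v w : F := 1 - dotB B v w ^+ 2 / (QB B v * QB B w).

End VectorAlgebra.

Section Projective.
Variable F : fieldType.
Implicit Types (B : 'M[F]_3) (v w : 'rV[F]_3).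

(* Equality modulo nonzero scalars, see [propor_P]. *)
Definition propor v w : bool := (v == w)%MS.

Lemma propor_P v w : reflect (exists2 c : F, c != 0 & v = c *: w) (propor v w).
Proof.
apply: (iffP idP) => [|[c c0 ->]]; last first.
  rewrite /propor scalemx_sub //= -{1}[w]scale1r -(mulVf c0) -scalerA.
  exact: scalemx_sub.
case/andP=> /sub_rVP[c vE] /sub_rVP[d wE].
have [c0|c0] := eqVneq c 0; last by exists c.
have v0 : v = 0 by rewrite vE c0 scale0r.
exists 1; first exact: oner_neq0.
by rewrite wE v0 !scaler0.
Qed.

Lemma propor_refl : reflexive propor.
Proof. by move=> v; rewrite /propor submx_refl. Qed.

Lemma propor_sym : symmetric propor.
Proof. by move=> v w; rewrite /propor andbC. Qed.

Lemma propor_trans : transitive propor.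
Proof.
move=> w v u /andP[vw wv] /andP[wu uw].
by rewrite /propor (submx_trans vw wu) (submx_trans uw wv).
Qed.

Canonical propor_equiv := EquivRel propor propor_refl propor_sym propor_trans.

(* The quotient of the whole space by the nonzero scalars, so that [pclass]
   is total. The projective vectors are its elements other than [pclass 0],
   whose only representative is the zero vector. *)
Definition pspace := {eq_quot propor_equiv}.
HB.instance Definition _ := Choice.on pspace.
HB.instance Definition _ := EqQuotient.on pspace.

Definition pclass v : pspace := \pi_pspace v.

Definition projective_vector (p : pspace) : bool := p != pclass 0.

Lemma pclass_eq v w : (pclass v == pclass w) = propor v w.
Proof. exact: piE. Qed.

Lemma projective_pclass v : projective_vector (pclass v) = (v != 0).
Proof.
rewrite /projective_vector pclass_eq; congr (~~ _).
apply/propor_P/eqP => [[c _ ->]|->]; first by rewrite scaler0.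
by exists 1; rewrite ?oner_neq0 ?scaler0.
Qed.

Definition tripod (p1 p2 p3 : pspace) : bool :=
  all projective_vector [:: p1; p2; p3] && uniq [:: p1; p2; p3].

(* Independent of the representatives, see [quadranceE]. *)
Definition quadrance B (p q : pspace) : F := spreadB B (repr p) (repr q).

Lemma dotBZ B c d v w : dotB B (c *: v) (d *: w) = c * d * dotB B v w.
Proof.
by rewrite /dotB linearZ /= -!scalemxAl -scalemxAr !mxE mulrA.
Qed.

Lemma quadranceE B v w : quadrance B (pclass v) (pclass w) = spreadB B v w.
Proof.
have reprE u : exists2 c : F, c != 0 & repr (pclass u) = c *: u.
  by apply/propor_P; rewrite -pclass_eq /pclass reprK.
rewrite /quadrance; have [c c0 ->] := reprE v; have [d d0 ->] := reprE w.
rewrite /spreadB /QB !dotBZ; congr (1 - _).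
have -> : c * c * dotB B v v * (d * d * dotB B w w)
          = (c * d) ^+ 2 * (dotB B v v * dotB B w w) by ring.
by rewrite exprMn -mulf_div divff ?mul1r // expf_neq0 // mulf_neq0.
Qed.

End Projective.

Section CommonValue.
Variables (F : fieldType) (B : 'M[F]_3).
Implicit Types v w : 'rV[F]_3.

Lemma dotB_sym v w : B^T = B -> dotB B v w = dotB B w v.
Proof.
move=> Bsym; rewrite /dotB -[in LHS](trmxK (v *m B *m w^T)) [LHS]mxE.
by rewrite !trmx_mul trmxK Bsym mulmxA.
Qed.

Lemma dotBE (A : 'M[F]_3) v w : dotB A v w =
  \sum_(i < 3) \sum_(j < 3) v 0 i * A i j * w 0 j.
Proof.
rewrite /dotB mxE exchange_big; apply: eq_bigr => j _.
by rewrite !mxE mulr_suml; apply: eq_bigr.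
Qed.

Let cof3 (i j i1 i2 j1 j2 : 'I_3) :
  lift i 0 = i1 -> lift i 1 = i2 -> lift j 0 = j1 -> lift j 1 = j2 ->
  cofactor B i j = (-1) ^+ (i + j) * (B i1 j1 * B i2 j2 - B i1 j2 * B i2 j1).
Proof.
move=> <- <- <- <-; rewrite /cofactor; congr (_ * _).
rewrite (expand_det_row _ ord0) !big_ord_recl big_ord0 addr0 /cofactor !det_mx11.
rewrite !mxE /= expr0 mul1r expr1 mulN1r mulrN.
by congr (B _ _ * B _ _ - B _ _ * B _ _); apply/val_inj.
Qed.

Lemma dotB_crossB v w v' w' :
  dotB B (crossB B v w) (crossB B v' w') =
  \det B * (dotB B v v' * dotB B w w' - dotB B v w' * dotB B w v').
Proof.
have -> : dotB B (crossB B v w) (crossB B v' w') =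
          \det B * dotB (\adj B)^T (cross v w) (cross v' w').
  rewrite /dotB /crossB trmx_mul -[X in X *m _]mulmxA mul_adj_mx.
  by rewrite mul_mx_scalar !mulmxA -!scalemxAl mxE.
congr (_ * _); rewrite !dotBE.
have ord3 (f : 'I_3 -> F) : \sum_(i < 3) f i = f 0 + f 1 + f 2%:R.
  rewrite !big_ord_recl big_ord0 addr0 addrA.
  by congr (_ + f _ + f _); apply/val_inj.
rewrite !ord3 !mxE /=.
have lift0 : (lift 0 0 = 1 :> 'I_3) * (lift 0 1 = 2%:R :> 'I_3).
  by split; apply/val_inj.
have lift1 : (lift 1 0 = 0 :> 'I_3) * (lift 1 1 = 2%:R :> 'I_3).
  by split; apply/val_inj.
have lift2 : (lift 2%:R 0 = 0 :> 'I_3) * (lift 2%:R 1 = 1 :> 'I_3).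
  by split; apply/val_inj.
rewrite !(cof3 erefl erefl erefl erefl) !lift0 !lift1 !lift2 /=.
ring.
Qed.

(* The projective quadrea does not depend on the chosen index. *)
Lemma quadrea_common v1 v2 v3 :
  B^T = B -> QB B v1 != 0 -> QB B v2 != 0 -> QB B v3 != 0 ->
  QB B (crossB B v2 v3) != 0 ->
  QB B (crossB B v1 v3) != 0 ->
  QB B (crossB B v1 v2) != 0 ->
  let q1 := quadrance B (pclass v2) (pclass v3) in
  let q2 := quadrance B (pclass v1) (pclass v3) in
  let q3 := quadrance B (pclass v1) (pclass v2) in
  let r1 := pclass (crossB B v2 v3) in
  let r2 := pclass (crossB B v1 v3) in
  let r3 := pclass (crossB B v1 v2) in
  let S1 := quadrance B r2 r3 in
  let S2 := quadrance B r1 r3 in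
  let S3 := quadrance B r1 r2 in
  S1 * q2 * q3 = S2 * q1 * q3 /\ S2 * q1 * q3 = S3 * q1 * q2.
Proof.
move=> Bsym; rewrite /= !quadranceE /spreadB /QB !dotB_crossB.
rewrite !(dotB_sym v2 v1) // !(dotB_sym v3 v1) // !(dotB_sym v3 v2) //.
move: (dotB B v1 v1) (dotB B v2 v2) (dotB B v3 v3) (\det B) => a b c d.
move: (dotB B v1 v2) (dotB B v1 v3) (dotB B v2 v3) => e f g.
move=> a0 b0 c0; rewrite !mulf_eq0 !negb_or.
move=> /andP[d0 h1] /andP[_ h2] /andP[_ h3].
by split; field; rewrite ?a0 ?b0 ?c0 ?d0 ?h1 ?h2 ?h3.
Qed.

End CommonValue.

(* Main.v *)
Require Import Defs.
From mathcomp Require Import all_boot all_order all_algebra.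
From mathcomp Require Import ring.

Import GRing.Theory.
Local Open Scope ring_scope.

(** The cross law is a statement about the Gram matrix of the three vectors.
   Write [a], [b], [c] for the quadratic values of [v1], [v2], [v3], and [e],
   [f], [g] for the products [v1.v2], [v1.v3], [v2.v3].  The quadrances satisfy
   [1 - q1 = g^2/(bc)], [1 - q2 = f^2/(ac)], [1 - q3 = e^2/(ab)], and the
   quadrea is the normalized Gram determinant
   [(abc + 2efg - ag^2 - bf^2 - ce^2)/(abc)] ([quadreaE]).  In
   [aB - q1 - q2 - q3 + 2] the constants and the three square terms cancel, so
   that only [2efg/(abc)] is left ([quadrea_defect]); its square is
   [4 (g^2/(bc)) (f^2/(ac)) (e^2/(ab))], which is the right-hand side. *)

Section CrossLaw.
Context {F : fieldType} {B : 'M[F]_3} {v1 v2 v3 : 'rV[F]_3}.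
Hypotheses (Bsym : B^T = B).
Hypotheses (Q1 : QB B v1 != 0) (Q2 : QB B v2 != 0) (Q3 : QB B v3 != 0).

(** By the Binet-Cauchy identity [dotB_crossB], [S1] involves
   [(ac - f^2)(ab - e^2) - (ag - ef)^2], a minor of the adjugate of the Gram
   matrix, hence (Jacobi) [a] times the Gram determinant.  The factors
   [ac - f^2] and [ab - e^2] in the denominator of [S1] are, up to [ac] and
   [ab], the quadrances [q2] and [q3], and so disappear in the product. *)
Lemma quadreaE :
  QB B (crossB B v1 v3) != 0 -> QB B (crossB B v1 v2) != 0 ->
  spreadB B (crossB B v1 v3) (crossB B v1 v2)
    * spreadB B v1 v3 * spreadB B v1 v2
  = (QB B v1 * QB B v2 * QB B v3
     + 2%:R * (dotB B v1 v2 * dotB B v1 v3 * dotB B v2 v3)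
     - QB B v1 * dotB B v2 v3 ^+ 2 - QB B v2 * dotB B v1 v3 ^+ 2
     - QB B v3 * dotB B v1 v2 ^+ 2) / (QB B v1 * QB B v2 * QB B v3).
Proof.
move: Q1 Q2 Q3; rewrite /spreadB /QB !dotB_crossB.
rewrite !(dotB_sym v2 v1) // !(dotB_sym v3 v1) // !(dotB_sym v3 v2) //.
move: (dotB B v1 v1) (dotB B v2 v2) (dotB B v3 v3) (\det B) => a b c d.
move: (dotB B v1 v2) (dotB B v1 v3) (dotB B v2 v3) => e f g.
move=> a0 b0 c0; rewrite !mulf_eq0 !negb_or => /andP[d0 h2] /andP[_ h3].
by field; rewrite ?a0 ?b0 ?c0 ?d0 ?h2 ?h3.
Qed.

Lemma quadrea_defect :
  QB B (crossB B v1 v3) != 0 -> QB B (crossB B v1 v2) != 0 ->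
  spreadB B (crossB B v1 v3) (crossB B v1 v2)
    * spreadB B v1 v3 * spreadB B v1 v2
    - spreadB B v2 v3 - spreadB B v1 v3 - spreadB B v1 v2 + 2%:R
  = 2%:R * (dotB B v1 v2 * dotB B v1 v3 * dotB B v2 v3)
    / (QB B v1 * QB B v2 * QB B v3).
Proof.
move=> R2 R3; rewrite quadreaE // /spreadB.
by field; rewrite Q1 Q2 Q3.
Qed.

End CrossLaw.

Theorem theorem26 (F : fieldType) (B : 'M[F]_3) (v1 v2 v3 : 'rV[F]_3) :
  2%N \notin [pchar F] ->
  B^T = B -> B \in unitmx ->
  let p1 := pclass v1 in let p2 := pclass v2 in let p3 := pclass v3 in
  tripod p1 p2 p3 ->
  QB B v1 != 0 -> QB B v2 != 0 -> QB B v3 != 0 ->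
  QB B (crossB B v2 v3) != 0 ->
  QB B (crossB B v1 v3) != 0 ->
  QB B (crossB B v1 v2) != 0 ->
  let q1 := quadrance B p2 p3 in
  let q2 := quadrance B p1 p3 in
  let q3 := quadrance B p1 p2 in
  let r1 := pclass (crossB B v2 v3) in
  let r2 := pclass (crossB B v1 v3) in
  let r3 := pclass (crossB B v1 v2) in
  let S1 := quadrance B r2 r3 in
  let S2 := quadrance B r1 r3 in
  let S3 := quadrance B r1 r2 in
  let aB := S1 * q2 * q3 in
  (aB - q1 - q2 - q3 + 2%:R) ^+ 2
  = 4%:R * (1 - q1) * (1 - q2) * (1 - q3).
Proof.
move=> _ Bsym _ p1 p2 p3 _ Q1 Q2 Q3 _ R2 R3 q1 q2 q3 r1 r2 r3 S1 S2 S3 aB.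
rewrite /aB /S1 /q1 /q2 /q3 /r2 /r3 /p1 /p2 /p3 !quadranceE.
rewrite quadrea_defect // /spreadB.
by field; rewrite Q1 Q2 Q3.
Qed.
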